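(* Let $H\in\mathbb{R}^{d\times d}$ be a nonzero (symmetric) positive semi-definite matrix with eigenvalues $\lambda_1,\dots,\lambda_d$. Then $$\Vert H\Vert_{\infty,1}\le \rho_{\mathrm{diag}}(H)^{-1}\sum_{i=1}^d\lambda_i,\qquad\text{where}\quad \rho_{\mathrm{diag}}(H):=\frac{\sum_{i}\vert H_{ii}\vert}{\sum_{i,j}\vert H_{ij}\vert}.$$
   Context: For $H\in\mathbb{R}^{d\times d}$, $\Vert H\Vert_{\infty,1}:=\max_{\Vert x\Vert_\infty\le 1}\Vert Hx\Vert_1$. Eigenvalues are counted with multiplicity. *)

(* Defs.v *)
From mathcomp Require Import all_boot all_order all_algebra.
From mathcomp Require Import all_classical all_reals all_analysis.
Import Order.TTheory GRing.Theory Num.Theory.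
Import numFieldNormedType.Exports.

Set Implicit Arguments.
Unset Strict Implicit.
Unset Printing Implicit Defensive.

Local Open Scope classical_set_scope.
Local Open Scope ring_scope.

Definition psdmx (R : realType) (d : nat) (H : 'M[R]_d) : Prop :=
  H^T = H /\ forall x : 'cV[R]_d, 0 <= (x^T *m H *m x) 0 0.

(* Algebraic multiplicities: lambda lists all d roots of the characteristic
   polynomial, each repeated according to its multiplicity. *)
Definition eigenvalues (R : realType) (d : nat) (H : 'M[R]_d)
    (lambda : 'I_d -> R) : Prop :=
  char_poly H = \prod_(i < d) ('X - (lambda i)%:P).

Definition norm1 (R : realType) (d : nat) (x : 'cV[R]_d) : R :=
  \sum_(i < d) `|x i 0|.

(* The library norm `|x| of a matrix is its largest absolute entry, which on
   column vectors is the l^oo norm. The supremum is a maximum: see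
   norm_oo1_attained. *)
Definition norm_oo1 (R : realType) (d : nat) (H : 'M[R]_d) : R :=
  sup [set norm1 (H *m x) | x in [set x : 'cV[R]_d | `|x| <= 1]].

Definition rho_diag (R : realType) (d : nat) (H : 'M[R]_d) : R :=
  (\sum_(i < d) `|H i i|) / (\sum_(i < d) \sum_(j < d) `|H i j|).

Lemma normr_cV_le1 (R : realType) (d : nat) (x : 'cV[R]_d) :
  (`|x| <= 1) <-> forall i, `|x i 0| <= 1.
Proof.
have -> : `|x| = \big[Order.max/0]_ij `|x ij.1 ij.2| by exact: mx_normrE.
split=> [/bigmax_leP[_ le1] i|le1].
  exact: (le1 (i, 0)).
by apply/bigmax_leP; split=> [|[i j] _] //=; rewrite (ord1 j).
Qed.

Lemma norm_oo1_attained (R : realType) (d : nat) (H : 'M[R]_d) :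
  exists2 x : 'cV[R]_d, `|x| <= 1 &
    norm1 (H *m x) = norm_oo1 H /\
    forall y : 'cV[R]_d, `|y| <= 1 -> norm1 (H *m y) <= norm1 (H *m x).
Proof.
pose A := [set v : 'rV[R]_d | forall i, `[-1, 1]%classic (v ord0 i)].
pose f (v : 'rV[R]_d) := norm1 (H *m v^T).
have AE (y : 'cV[R]_d) : A y^T <-> `|y| <= 1.
  rewrite normr_cV_le1; split=> h i; move: (h i);
    by rewrite /= ?mxE in_itv/= ler_norml.
have cH i : continuous (fun v : 'rV[R]_d => (H *m v^T) i 0).
  have -> : (fun v : 'rV[R]_d => (H *m v^T) i 0) =
      (fun v => \sum_j H i j * v 0 j).
    by apply/funext => v; rewrite mxE; apply: eq_bigr => j _; rewrite mxE.
  apply: continuous_big => [|j _ v]; first exact: add_continuous.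
  by apply: cvgMl_tmp; [exact: (nbhs_filter v)|exact: coord_continuous].
have cf : {within A, continuous f}.
  apply: continuous_subspaceT; apply: continuous_big => [|i _ v].
    exact: add_continuous.
  by apply: cvg_norm; [exact: (nbhs_filter v)|exact: cH].
have A0 : A !=set0.
  exists 0 => i /=; rewrite mxE in_itv/=.
  by rewrite lerN10 ler01.
have cA : compact A.
  by apply: (@rV_compact R d (fun=> `[-1, 1]%classic)) => _;
    exact: segment_compact.
have [c /[!inE] Ac cmax] := EVT_max_rV A0 cA cf.
have c1 : `|c^T| <= 1 by apply/AE; rewrite trmxK.
have cub (y : 'cV[R]_d) : `|y| <= 1 -> norm1 (H *m y) <= norm1 (H *m c^T).
  by move=> /AE Ay; move: (cmax y^T); rewrite inE /f trmxK; exact.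
exists c^T => //; split=> //; apply/eqP; rewrite eq_le; apply/andP; split.
  apply: ub_le_sup; last by exists c^T.
  by exists (norm1 (H *m c^T)) => _ [y y1 <-]; exact: cub.
apply: ge_sup; first by exists (norm1 (H *m c^T)), c^T.
by move=> _ [y y1 <-]; exact: cub.
Qed.

(* Main.v *)
Require Import Defs.
From mathcomp Require Import all_boot all_order all_algebra.
From mathcomp Require Import all_classical all_reals all_analysis.
From mathcomp Require Import lra.
Import Order.TTheory GRing.Theory Num.Theory.
Import numFieldNormedType.Exports.
Local Open Scope ring_scope.

(** [norm_oo1 H] is at most the sum of all [`|H i j|]. The trace of [H] is the
    sum of the eigenvalues and, the diagonal being nonnegative, also the
    numerator of [rho_diag H], so the right-hand side is that same sum as
    soon as the trace is nonzero; it is, because a positive semi-definite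
    matrix with zero trace vanishes. *)

(** Both sides are, up to sign, the coefficient of degree [d - 1] in [char_poly H]; for [d = 0]
    there is no such coefficient, but both sums are empty. *)
Lemma eigenvalues_trace (R : realType) (d : nat) (H : 'M[R]_d)
    (lambda : 'I_d -> R) :
  eigenvalues H lambda -> \sum_(i < d) lambda i = \tr H.
Proof.
case: d H lambda => [|d] H lambda hl; first by rewrite /mxtrace !big_ord0.
apply: oppr_inj; rewrite -char_poly_trace // hl.
have := @coefPn_prod_XsubC R [seq lambda i | i : 'I_d.+1].
by rewrite !big_image size_image card_ord => ->.
Qed.

(** Used to evaluate the quadratic form at a basis vector, and at sums and differences of two of
    them. *)
Lemma quad_delta (R : nzRingType) (d : nat) (H : 'M[R]_d) (i j : 'I_d) :
  (delta_mx i (0 : 'I_1))^T *m H *m delta_mx j (0 : 'I_1) = (H i j)%:M.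
Proof.
apply/matrixP => a b; rewrite !ord1 trmx_delta -rowE -colE !mxE.
by rewrite eqxx mulr1n.
Qed.

Lemma psdmx_diag_ge0 (R : realType) (d : nat) (H : 'M[R]_d) (i : 'I_d) :
  psdmx H -> 0 <= H i i.
Proof. by move=> [_ /(_ (delta_mx i 0))]; rewrite quad_delta mxE mulr1n. Qed.

Lemma psdmx_trace_eq0 (R : realType) (d : nat) (H : 'M[R]_d) :
  psdmx H -> \tr H = 0 -> H = 0.
Proof.
move=> Hpsd tr0; have [Hsym Hge0] := Hpsd.
have diag0 i : H i i = 0.
  by apply: (psumr_eq0P _ tr0) => // k _; exact: psdmx_diag_ge0.
apply/matrixP => i j; rewrite mxE.
have Hji : H j i = H i j by rewrite -{1}Hsym mxE.
(* with a zero diagonal, the form takes the values [+- 2 H i j] at [e_i +- e_j] *)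
have := Hge0 (delta_mx i 0 + delta_mx j 0).
have := Hge0 (delta_mx i 0 - delta_mx j 0).
rewrite !raddfB !raddfD /= !mulmxBl !mulmxDl !quad_delta.
rewrite !mxE !mulr1n !diag0 Hji => h1 h2.
by apply/eqP; rewrite eq_le; apply/andP; split; lra.
Qed.

(** Triangle inequality in each row, at a maximiser [x], whose entries have absolute value at most
    1. *)
Lemma norm_oo1_le_sum (R : realType) (d : nat) (H : 'M[R]_d) :
  norm_oo1 H <= \sum_(i < d) \sum_(j < d) `|H i j|.
Proof.
have [x /normr_cV_le1 x1 [<- _]] := norm_oo1_attained H.
apply: ler_sum => i _; rewrite mxE; apply: le_trans (ler_norm_sum _ _ _) _.
by apply: ler_sum => j _; rewrite normrM ler_piMr.
Qed.

Theorem proposition4 (R : realType) (d : nat) (H : 'M[R]_d)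
    (lambda : 'I_d -> R) (hH0 : H <> 0) (hHpsd : psdmx H)
    (hlambda : eigenvalues H lambda) :
  norm_oo1 H <= (rho_diag H)^-1 * \sum_(i < d) lambda i.
Proof.
have diagE : \sum_(i < d) `|H i i| = \tr H.
  by apply: eq_bigr => i _; rewrite ger0_norm// psdmx_diag_ge0.
have tr0 : \tr H != 0 by apply/eqP => /(psdmx_trace_eq0 _ _ _ hHpsd).
rewrite (eigenvalues_trace _ _ _ _ hlambda) /rho_diag diagE invf_div divfK//.
exact: norm_oo1_le_sum.
Qed.
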